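(* Let $k\geq3$ and $n\geq3$. Then the conditional matching preclusion number of the DCell is $mp_1(D_{k,n})=2n+2k-5$. Moreover, $D_{k,n}$ is conditionally super matched for $k\geq4$ and $n\geq3$.
   Context: DCell $D_{k,n}$ ($n\geq 2$, $k\geq 0$) is defined recursively. $D_{0,n}$ is the complete graph $K_n$ on vertices $0,1,\dots,n-1$. Let $t_{k,n}=|V(D_{k,n})|$. For $k\geq1$, $D_{k,n}$ is built from $t_{k-1,n}+1$ disjoint copies $D^0_{k-1,n},\dots,D^{t_{k-1,n}}_{k-1,n}$ of $D_{k-1,n}$; a vertex of copy $D^i_{k-1,n}$ is labeled $(i,a_{k-1},\dots,a_0)$, where $(a_{k-1},\dots,a_0)$ is its label in $D_{k-1,n}$, and its index within the copy is $uid_{k-1}=a_0+\sum_{l=1}^{k-1}a_l t_{l-1,n}$. For each pair $a<b$ of copy indices, one edge joins the vertex of $D^a_{k-1,n}$ with $uid_{k-1}=b-1$ to the vertex of $D^b_{k-1,n}$ with $uid_{k-1}=a$. For a graph $G$ of even order, $mp_1(G)$ is the minimum number of edges whose deletion yields a graph with neither a perfect matching nor an isolated vertex. Let $v_e(G)=\min\{d_G(u)+d_G(w)-2-y_G(u,w)\}$ over all pairs $u,w$ that are the ends of a path $u v w$ of length $2$, where $y_G(u,w)=1$ if $uw\in E(G)$ and $0$ otherwise. A trivial optimal conditional solution is, for such a path $uvw$ attaining $v_e(G)$, the set of all edges incident to $u$ or $w$ other than $uv$ and $vw$. $G$ is conditionally super matched if $mp_1(G)=v_e(G)$ and every set of $mp_1(G)$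 edges whose deletion leaves a graph with no perfect matching and no isolated vertex is a trivial optimal conditional solution. *)

(* Defs.v *)
(* MathComp. *)
From mathcomp Require Import all_boot.

Set Implicit Arguments.
Unset Strict Implicit.
Unset Printing Implicit Defensive.

Record sgraph := SGraph {
  svertex :> finType;
  adj : rel svertex;
  adj_sym : symmetric adj;
  adj_irrefl : irreflexive adj
}.

Section Graphs.
Variable G : sgraph.
Implicit Types (u v w : G) (F M : {set {set G}}).

Definition edges : {set {set G}} :=
  [set e | [exists u, exists v, adj u v && (e == [set u; v])]].

Definition degree v := #|[set w | adj v w]|.

Definition has_isolated_vertex := [exists v, degree v == 0].

Definition matching M := (M \subset edges) && trivIset M.

Definition perfect_matching M := matching M && (cover M == [set: G]).

Definition has_perfect_matching := [exists M, perfect_matching M].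

Definition delete_adj F : rel G := fun u v => adj u v && ([set u; v] \notin F).

Lemma delete_adj_sym F : symmetric (delete_adj F).
Proof. by move=> u v; rewrite /delete_adj adj_sym setUC. Qed.

Lemma delete_adj_irrefl F : irreflexive (delete_adj F).
Proof. by move=> u; rewrite /delete_adj adj_irrefl. Qed.

Definition delete_edges F : sgraph :=
  SGraph (@delete_adj_sym F) (@delete_adj_irrefl F).

End Graphs.

Section ConditionalMatchingPreclusion.
Variable G : sgraph.
Implicit Types (u v w : G) (F : {set {set G}}).

Definition cond_preclusion_set F :=
  [&& F \subset edges G,
      ~~ has_perfect_matching (delete_edges F) &
      ~~ has_isolated_vertex (delete_edges F)].

(* The minima mp_1 and v_e are rendered as relations "the minimum exists and
   equals m", so that no default value is needed for a minimum over an empty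
   family. *)
Definition is_mp1 (m : nat) : Prop :=
  (exists2 F, cond_preclusion_set F & #|F| = m) /\
  (forall F, cond_preclusion_set F -> m <= #|F|).

Definition path2 u v w := [&& adj u v, adj v w & u != w].

(* The boolean [adj u w], coerced to nat, is y_G(u,w); the subtraction is never
   truncated when u and w are the ends of a path of length 2. *)
Definition ve_value u w : nat := degree u + degree w - 2 - adj u w.

Definition is_ve (m : nat) : Prop :=
  (exists u v w, path2 u v w /\ ve_value u w = m) /\
  (forall u v w, path2 u v w -> m <= ve_value u w).

Definition trivial_optimal_solution F : Prop :=
  exists u v w, [/\ path2 u v w, is_ve (ve_value u w) &
    F = [set e in edges G | ((u \in e) || (w \in e)) &&
                            (e \notin [set [set u; v]; [set v; w]])]].

Definition cond_super_matched : Prop :=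
  exists m, [/\ is_mp1 m, is_ve m &
    forall F, cond_preclusion_set F -> #|F| = m -> trivial_optimal_solution F].

End ConditionalMatchingPreclusion.

(* The label (a_k, ..., a_0) is encoded as the nested pair
   (a_k, (a_(k-1), ... (a_1, a_0))), with a_(l+1) ranging over the
   t_{l,n} + 1 copies of D_{l,n}. *)
Fixpoint dcell_vertex (n k : nat) : finType :=
  if k is l.+1 then ('I_(#|dcell_vertex n l|.+1) * dcell_vertex n l)%type
  else 'I_n.

Definition dcell_order n k := #|dcell_vertex n k|.

Fixpoint uid (n k : nat) : dcell_vertex n k -> nat :=
  match k with
  | 0 => fun a0 : 'I_n => val a0
  | l.+1 => fun x : 'I_(dcell_order n l).+1 * dcell_vertex n l =>
      uid x.2 + x.1 * dcell_order n l
  end.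

(* For a < b, the edge between copies a and b joins uid b-1 in copy a to uid a
   in copy b; the last two cases are this rule in both orientations. *)
Fixpoint dcell_adj (n k : nat) : rel (dcell_vertex n k) :=
  match k with
  | 0 => fun x y : 'I_n => x != y
  | l.+1 => fun x y : 'I_(dcell_order n l).+1 * dcell_vertex n l =>
      if x.1 == y.1 then dcell_adj x.2 y.2
      else if x.1 < y.1 then (uid x.2 == y.1.-1) && (uid y.2 == x.1)
      else (uid y.2 == x.1.-1) && (uid x.2 == y.1)
  end.

Lemma dcell_adj_sym n k : symmetric (@dcell_adj n k).
Proof.
elim: k => [|k IHk] x y /=; first by rewrite eq_sym.
rewrite [y.1 == x.1]eq_sym; case: eqP => [_|/eqP neq]; first exact: IHk.
by case: ltngtP => // /val_inj /eqP; rewrite (negPf neq).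
Qed.

Lemma dcell_adj_irrefl n k : irreflexive (@dcell_adj n k).
Proof. by elim: k => [|k IHk] x /=; rewrite eqxx ?IHk. Qed.

Definition DCell k n : sgraph :=
  SGraph (@dcell_adj_sym n k) (@dcell_adj_irrefl n k).

(* Main.v *)
Require Import Defs.
From mathcomp Require Import all_boot.
From mathcomp Require Import zify.
From Stdlib Require Import Classical.

(* By Tutte's theorem, if G - F has no perfect matching then some set S leaves a
   splitting of the other vertices into parts, joined in G - F by no edge, of
   which at least |S| + 2 are odd.  Counting in the r-regular graph G the edges
   that leave the parts, the sum of (cut C - r [C odd]) over the parts C is at
   most 2|F| - 2r.  In a DCell every cut is at least r, every cut with at least
   two vertices on both sides is at least 2r - 2, with three on both sides at
   least 3r - 6, and (for k >= 4) with four on both sides at least 3r - 5.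
   Hence, for |F| <= 2r - 3 and no isolated vertex, either all parts are single
   vertices, which is impossible since each of the many copies of D_(k-1)
   contains a triangle, or one part is the complement of a triangle u, v, w with
   S = {v}, and then F contains the edges at u or w other than uv and vw. *)

Set Implicit Arguments.
Unset Strict Implicit.
Unset Printing Implicit Defensive.

(** * Hall's marriage theorem *)

Section Hall.
Variables (I T : finType).

Definition nbhd (R : I -> pred T) (K : {set I}) : {set T} :=
  [set s | [exists c in K, R c s]].

(** Induction on [#|X|]. If some non-empty proper [Y] is tight, [Y] and [X :\: Y] are matched
    separately, the latter avoiding the neighbours of [Y]. Otherwise each such set has a neighbour
    to spare, and any [c0] may take any neighbour [s0]. [t0] provides the function when [X] is
    empty. *)
Lemma hall (t0 : T) (X : {set I}) (R : I -> pred T) :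
  (forall K : {set I}, K \subset X -> #|K| <= #|nbhd R K|) ->
  exists2 g : I -> T, {in X &, injective g} & {in X, forall c, R c (g c)}.
Proof.
move: {2}#|X| (leqnn #|X|) => m; elim: m X R => [|m IHm] X R leXm hallX.
  have X0 : X = set0 by apply/eqP; rewrite -cards_eq0 -leqn0.
  by exists (fun=> t0) => [c c'|c]; rewrite X0 inE.
have split_at (Y : {set I}) : Y \proper X -> 0 < #|Y| -> #|nbhd R Y| <= #|Y| ->
    exists2 g : I -> T, {in X &, injective g} & {in X, forall c, R c (g c)}.
  move=> /properP[sYX [c0 c0X c0Y]] Y_gt0 tight.
  have cardXY : #|Y| + #|X :\: Y| = #|X|.
    by rewrite cardsD (setIidPr sYX) subnKC // subset_leq_card.
  have XY_gt0 : 0 < #|X :\: Y| by apply/card_gt0P; exists c0; rewrite inE c0Y.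
  have [||g1 inj1 R1] := IHm Y R; first by lia.
    by move=> K sKY; apply: hallX; apply: subset_trans sYX.
  have [||g2 inj2 R2] := IHm (X :\: Y) (fun c s => R c s && (s \notin nbhd R Y)).
  - by lia.
  - move=> K; rewrite subsetD => /andP[sKX dKY].
    (* The condition for [K :|: Y], less the tight count for [Y], is the condition for [K] in the
       reduced relation. *)
    have := hallX (K :|: Y); rewrite subUset sKX => /(_ sYX).
    rewrite cardsU disjoint_setI0 // cards0 subn0.
    have : nbhd R (K :|: Y) \subset
        nbhd (fun c s => R c s && (s \notin nbhd R Y)) K :|: nbhd R Y.
      apply/subsetP=> s; rewrite !inE => /exists_inP[c].
      case: (boolP [exists c in Y, R c s]); first by rewrite orbT.
      move=> nY; rewrite inE => /orP[cK|cY] Rcs; last first.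
        by case/exists_inP: nY; exists c.
      by rewrite orbF; apply/exists_inP; exists c; rewrite // Rcs.
    by move=> /subset_leq_card; rewrite cardsU; lia.
  exists (fun c => if c \in Y then g1 c else g2 c).
    have sep c c' : c \in Y -> c' \in X -> c' \notin Y -> g1 c <> g2 c'.
      move=> cY cX' cY' eqg; have := R2 c'; rewrite inE cY' cX' => /(_ isT).
      case/andP=> _; rewrite -eqg inE => /negP[].
      by apply/exists_inP; exists c; last exact: R1.
    move=> c c' cX cX'; case: ifPn => cY; case: ifPn => cY'.
    + exact: inj1.
    + by move/sep; case.
    + by move/esym/sep; case.
    + by apply: inj2; rewrite inE ?cY ?cY'.
  move=> c cX; case: ifPn => cY; first exact: R1.
  by have := R2 c; rewrite inE cY cX => /(_ isT)/andP[].
have [/existsP[Y /and3P[]]|] := boolP [exists Y : {set I},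
  [&& Y \proper X, 0 < #|Y| & #|nbhd R Y| <= #|Y|]]; first exact: split_at.
rewrite negb_exists => /forallP noY.
have [->|[c0 c0X]] := set_0Vmem X.
  by exists (fun=> t0) => [c c'|c]; rewrite inE.
have /card_gt0P[s0] : 0 < #|nbhd R [set c0]|.
  by have := hallX [set c0]; rewrite sub1set cards1; apply.
rewrite inE => /exists_inP[_ /set1P-> Rc0s0].
have cardX : #|X| = #|X :\ c0|.+1 by rewrite (cardsD1 c0) c0X.
have [||g ginj gR] := IHm (X :\ c0) (fun c s => R c s && (s != s0)).
- by lia.
- move=> K; rewrite subsetD1 => /andP[sKX Kc0].
  have [->|K_gt0] := posnP #|K|; first by [].
  have := noY K; rewrite K_gt0 properE sKX.
  have -> /= : ~~ (X \subset K).
    by apply/negP=> /subsetP /(_ c0 c0X) c0K; rewrite c0K in Kc0.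
  have : nbhd R K \subset s0 |: nbhd (fun c s => R c s && (s != s0)) K.
    apply/subsetP=> s; rewrite !inE; case: eqP => //= /eqP ss0 /exists_inP[c cK Rcs].
    by apply/exists_inP; exists c; rewrite // Rcs.
  by move=> /subset_leq_card; rewrite cardsU1; lia.
exists (fun c => if c == c0 then s0 else g c).
  move=> c c' cX cX'; case: eqP => [->|/eqP nc]; case: eqP => [->|/eqP nc'] //.
  - by move=> E; have := gR c'; rewrite !inE nc' cX' -E eqxx andbF => /(_ isT).
  - by move=> E; have := gR c; rewrite !inE nc cX E eqxx andbF => /(_ isT).
  - by apply: ginj; rewrite !inE ?nc ?nc'.
move=> c cX; case: eqP => [->|/eqP nc] //.
by have := gR c; rewrite !inE nc cX => /(_ isT)/andP[].
Qed.

End Hall.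

(** * Vertex sets covered exactly by disjoint edges *)

Section Matchable.
Variables (T : finType) (e : rel T).

(** Inductive, so that matchings can be glued without handling sets of edges; such a set is
    extracted only in [matchable_trivIset]. *)
Inductive matchable : {set T} -> Prop :=
| Matchable0 : matchable set0
| MatchableU2 x y (A : {set T}) of e x y & x \notin A & y \notin A & matchable A :
    matchable (x |: (y |: A)).

Lemma matchableU A B :
  matchable A -> matchable B -> [disjoint A & B] -> matchable (A :|: B).
Proof.
move=> mA mB; elim: mA => [|x y A' exy xA yA _ IH]; first by rewrite set0U.
move=> dAB; rewrite -!setUA; apply: MatchableU2 => //.
- by rewrite inE negb_or xA (disjointFr dAB) ?inE ?eqxx.
- by rewrite inE negb_or yA (disjointFr dAB) ?inE ?eqxx ?orbT.
apply: IH; apply: disjointWl dAB.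
by rewrite setUA subsetUr.
Qed.

Lemma matchable_fibers (L : finType) (h : T -> L) (A : {set T}) :
  (forall c, matchable [set x in A | h x == c]) -> matchable A.
Proof.
move=> mfib.
have mseq (s : seq L) : uniq s -> matchable [set x in A | h x \in s].
  elim: s => [|c s IHs] /=.
    have -> : [set x in A | h x \in [::]] = set0.
      by apply/setP=> x; rewrite !inE andbF.
    by move=> _; apply: Matchable0.
  case/andP=> cs us.
  have -> : [set x in A | h x \in c :: s] =
      [set x in A | h x == c] :|: [set x in A | h x \in s].
    by apply/setP=> x; rewrite !inE andb_orr.
  apply: matchableU; [exact: mfib | exact: IHs |].
  rewrite -setI_eq0; apply/eqP/setP=> x; rewrite !inE.
  by case: eqP => [->|]; rewrite ?(negPf cs) ?andbF.
have -> : A = [set x in A | h x \in enum L].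
  by apply/setP=> x; rewrite inE mem_enum andbT.
exact/mseq/enum_uniq.
Qed.

Lemma matchable_trivIset A : matchable A ->
  exists M : {set {set T}}, [/\ trivIset M, cover M = A &
    forall f, f \in M -> exists x y, e x y /\ f = [set x; y]].
Proof.
elim=> [|x y A' exy xA yA _ [M [tM cM eM]]].
  exists set0; split=> [||f]; rewrite ?inE //.
    by apply/trivIsetP=> ? ?; rewrite inE.
  by rewrite /cover big_set0.
have dxy B : B \in M -> [disjoint [set x; y] & B].
  move=> BM; have sBA : B \subset A' by rewrite -cM; apply: bigcup_sup.
  rewrite -setI_eq0; apply/eqP/setP=> z; rewrite !inE.
  apply/negP=> /andP[/pred2P[]-> /(subsetP sBA)]; exact/negP.
exists ([set x; y] |: M); split.
- apply/trivIsetP=> B C; rewrite !inE => /predU1P[->|BM] /predU1P[->|CM] nBC.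
  + by rewrite eqxx in nBC.
  + exact: dxy.
  + by rewrite disjoint_sym dxy.
  + by move/trivIsetP: tM; apply.
- by rewrite /cover bigcup_setU big_set1 -/(cover M) cM setUA.
- by move=> f; rewrite !inE => /predU1P[->|/eM //]; exists x, y.
Qed.

End Matchable.

(** * Tutte's theorem, in the direction that produces a barrier *)

Section Tutte.
Variables (T : finType) (e : rel T).
Hypothesis e_sym : symmetric e.

(** Labellings replace connected components: a fiber of a separating labelling is a union of
    components. Such splittings are easy to refine or merge, and the later counting needs no
    connected parts. *)
Definition fiber (L : finType) (l : T -> L) (D : {set T}) (c : L) : {set T} :=
  [set x in D | l x == c].

Definition odd_fibers (L : finType) (l : T -> L) (D : {set T}) : {set L} :=
  [set c | odd #|fiber l D c|].

Definition separates (L : finType) (l : T -> L) (D : {set T}) :=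
  {in D &, forall x y, e x y -> l x = l y}.

Lemma sum_fiber (L : finType) (l : T -> L) (D : {set T}) :
  \sum_c #|fiber l D c| = #|D|.
Proof.
rewrite -sum1_card (partition_big l xpredT) //=; apply: eq_bigr => c _.
by rewrite -sum1_card; apply: eq_bigl => x; rewrite inE.
Qed.

Lemma odd_card_odd_fibers (L : finType) (l : T -> L) (D : {set T}) :
  odd #|odd_fibers l D| = odd #|D|.
Proof.
rewrite -(sum_fiber l) -sum1_card.
rewrite (big_morph odd oddD (erefl : odd 0 = false)).
rewrite (big_morph odd oddD (erefl : odd 0 = false)).
by rewrite big_mkcond; apply: eq_bigr => c _; rewrite inE; case: odd.
Qed.

(* Gallai-style induction: among the tight pairs (S, l), those with #|S| maximal
   have only odd fibers, all of them factor-critical, and Hall's theorem then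
   matches the fibers into S. *)
Theorem tutte (A : {set T}) :
  ~ matchable e A ->
  exists (L : finType) (l : T -> L) (S : {set T}),
    [/\ S \subset A, separates l (A :\: S) & #|S| < #|odd_fibers l (A :\: S)|].
Proof.
move: {2}#|A| (leqnn #|A|) => m; elim: m A => [|m IHm] A leAm nmA.
  by case: nmA; move: leAm; rewrite leqn0 cards_eq0 => /eqP->; apply: Matchable0.
apply: NNPP => nobad.
have ok (L : finType) (l : T -> L) (S : {set T}) : S \subset A ->
    separates l (A :\: S) -> #|odd_fibers l (A :\: S)| <= #|S|.
  move=> sSA sepl; rewrite leqNgt; apply/negP => lt; apply: nobad.
  by exists L, l, S.
(* The empty [S] is always tight, so it suffices to refute every tight pair, by induction on a bound
   [d] for [#|A| - #|S|]: a larger tight [S] falls under the induction hypothesis. *)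
suff notight d (L : finType) (l : T -> L) (S : {set T}) : S \subset A ->
    separates l (A :\: S) -> #|S| <= #|odd_fibers l (A :\: S)| ->
    #|A| - #|S| < d -> False.
  apply: (notight _ unit (fun=> tt) set0 _ _ _ (ltnSn _)).
  - by rewrite sub0set.
  - by [].
  - by rewrite cards0.
elim: d L l S => // d IHd L l S sSA sepl tight ltd.
set D := A :\: S in sepl tight; set X := odd_fibers l D in tight.
have DA : D \subset A by rewrite subsetDl.
(* Moving one vertex of an even fiber into [S] leaves that fiber odd, hence a larger tight pair. *)
have all_odd x : x \in D -> odd #|fiber l D (l x)|.
  move=> xD; apply/negPn/negP => evx; have := xD; rewrite inE => /andP[xS xA].
  have sub : D :\ x \subset D by rewrite subsetDl.
  have eqD : A :\: (x |: S) = D :\ x by rewrite setUC setDDl.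
  apply: (IHd L l (x |: S)).
  - by rewrite subUset sub1set xA.
  - rewrite eqD => y z yD zD; apply: sepl; exact: (subsetP sub).
  - rewrite cardsU1 xS eqD; apply: leq_ltn_trans tight _.
    apply: (@leq_trans #|l x |: X|); first by rewrite cardsU1 inE evx.
    apply: subset_leq_card; apply/subsetP=> c; rewrite !inE.
    have [-> _|nc /=] := eqVneq c (l x).
      have -> : fiber l (D :\ x) (l x) = fiber l D (l x) :\ x.
        by apply/setP=> y; rewrite !inE -!andbA.
      by have := cardsD1 x (fiber l D (l x)); rewrite inE xD eqxx => /(congr1 odd) /=;
        rewrite (negPf evx) => /esym/negbFE.
    suff -> : fiber l (D :\ x) c = fiber l D c by [].
    apply/setP=> y; rewrite !inE; case: eqP => // -> /=.
    by rewrite eq_sym (negPf nc) !andbF.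
  - have : #|x |: S| <= #|A| by rewrite subset_leq_card // subUset sub1set xA.
    by rewrite cardsU1 xS; lia.
(* Otherwise [B] has a bad set [R], and since [#|B|] is even the surplus of odd parts is at least 2.
   Adding [x] and [R] to [S] loses one odd fiber and gains at least [#|R| + 2], so the pair stays
   tight. *)
have crit x : x \in D -> matchable e (fiber l D (l x) :\ x).
  move=> xD; apply: NNPP; set B := _ :\ x => nmB.
  have cardB : #|fiber l D (l x)| = #|B|.+1.
    by rewrite (cardsD1 x) inE xD eqxx.
  have sBD : B \subset D by apply/subsetP=> y; rewrite !inE => /and3P[].
  have xB : x \notin B by rewrite !inE eqxx.
  have xS : x \notin S by move: xD; rewrite inE => /andP[].
  have xA : x \in A by apply: subsetP DA _ xD.
  have ltB : #|B| <= m.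
    rewrite -ltnS; apply: leq_trans leAm; rewrite -cardB subset_leq_card //.
    by apply: subset_trans DA; apply/subsetP=> y; rewrite inE => /andP[].
  have [L2 [l2 [R [sRB sep2 badR]]]] := IHm B ltB nmB.
  have evB : ~~ odd #|B| by have := all_odd x xD; rewrite cardB.
  have dRxS : [disjoint R & x |: S].
    rewrite -setI_eq0; apply/eqP/setP=> y; rewrite !inE; apply/negP=> /andP[yR].
    have yB := subsetP sRB y yR; case/orP=> [/eqP yx|yS].
      by rewrite -yx yB in xB.
    by have := subsetP sBD y yB; rewrite inE yS.
  have bad2 : #|R| + 2 <= #|odd_fibers l2 (B :\: R)|.
    have := odd_card_odd_fibers l2 (B :\: R).
    rewrite cardsDS // oddB ?subset_leq_card // (negPf evB) /= => par.
    rewrite addn2; move: badR; rewrite leq_eqVlt => /predU1P[E|//].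
    by move: par; rewrite -E /=; case: odd.
  pose S' := R :|: (x |: S).
  (* The sum type keeps the refined labels inside [B] apart from the old ones. *)
  pose l' y := if y \in B then inr (l2 y) else inl (l y).
  have inD' y : (y \in A :\: S') = [&& y \notin R, y != x & y \in D].
    by rewrite !inE !negb_or -!andbA.
  have cardS' : #|S'| = #|R| + #|S|.+1.
    by rewrite cardsU disjoint_setI0 // cards0 subn0 cardsU1 xS.
  have sS'A : S' \subset A.
    rewrite !subUset sub1set xA sSA !andbT.
    exact: subset_trans sRB (subset_trans sBD DA).
  apply: (IHd (L + L2)%type l' S') => //.
  - have sepl' y z : y \in A :\: S' -> z \in A :\: S' -> y \in B ->
        e y z -> l' y = l' z.
      rewrite !inD' => /and3P[yR yx yD] /and3P[zR zx zD] yB eyz.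
      have zB : z \in B.
        rewrite !inE zx; move: (zD); rewrite inE => -> /=.
        by rewrite -(sepl _ _ yD zD eyz); move: yB; rewrite !inE => /and3P[].
      by rewrite /l' yB zB (sep2 y z) // inE ?yR ?zR.
    move=> y z yD zD eyz; have [yB|yB] := boolP (y \in B); first exact: sepl'.
    have [zB|zB] := boolP (z \in B).
      by apply/esym/sepl' => //; rewrite e_sym.
    rewrite /l' (negPf yB) (negPf zB) (sepl y z) //.
      by move: yD; rewrite inD' => /and3P[].
    by move: zD; rewrite inD' => /and3P[].
  - have sub : [set inl c | c in X :\ l x] :|: [set inr c | c in odd_fibers l2 (B :\: R)]
        \subset odd_fibers l' (A :\: S').
      apply/subsetP=> c; rewrite inE => /orP[]/imsetP[c' c'X ->]; rewrite inE.
        move: c'X; rewrite !inE => /andP[nc' oc'].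
        suff -> : fiber l' (A :\: S') (inl c') = fiber l D c' by [].
        apply/setP=> y; rewrite !inE -/D; have := inD' y; rewrite !inE => ->.
        rewrite -!andbA /l'; case: ifPn => yB.
          rewrite !andbF; apply/esym/negP=> /and3P[_ _ /eqP yc'].
          by move: yB; rewrite !inE yc' (negPf nc') !andbF.
        have [yR|yR] /= := boolP (y \in R); first by rewrite (subsetP sRB) in yB.
        rewrite (inj_eq (@inl_inj _ _)).
        by have [->|//] := eqVneq y x; rewrite eq_sym (negPf nc') !andbF.
      move: c'X; rewrite inE.
      suff -> : fiber l' (A :\: S') (inr c') = fiber l2 (B :\: R) c' by [].
      apply/setP=> y; rewrite inE inD' [RHS]inE [y \in B :\: R]inE /l'.
      case: ifPn => yB; last by rewrite !andbF.
      rewrite (inj_eq (@inr_inj _ _)) (subsetP sBD y yB) !andbT.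
      have yx : y != x by apply: contraNneq xB => yx; rewrite -{1}yx.
      by rewrite yx andbT.
    apply: leq_trans (subset_leq_card sub).
    rewrite cardsU disjoint_setI0; last first.
      rewrite -setI_eq0; apply/eqP/setP=> c; rewrite !inE.
      by apply/negP=> /andP[/imsetP[? _ ->] /imsetP[]].
    rewrite cards0 subn0 !card_imset; try by [exact: inl_inj|exact: inr_inj].
    have := cardsD1 (l x) X; rewrite inE all_odd // cardS'.
    by move: tight bad2; clear; lia.
  - by have := subset_leq_card sS'A; rewrite cardS'; move: ltd; clear; lia.
have [a aA] : exists a, a \in A.
  have [A0|[a aA]] := set_0Vmem A; last by exists a.
  by case: nmA; rewrite A0; apply: Matchable0.
pose R c s := (s \in S) && [exists x in D, (l x == c) && e x s].
(* Hall's condition: once [S' := nbhd R K] is removed, the fibers with label in [K] have no edge to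
   the rest of [A]. They remain odd parts while everything else is merged under [None], so [ok]
   bounds their number by [#|S'|]. *)
have [K sKX|g ginj gR] := @hall L T a X R.
  pose S' := nbhd R K.
  have sS'S : S' \subset S.
    by apply/subsetP=> s; rewrite inE => /exists_inP[c _ /andP[]].
  pose l' y := if (y \in D) && (l y \in K) then Some (l y) else None.
  have sep' y z : y \in A :\: S' -> z \in A :\: S' -> (y \in D) && (l y \in K) ->
      e y z -> l' y = l' z.
    move=> yD' /setDP[zA zS'] /andP[yD yK] eyz.
    have zD : z \in D.
      rewrite inE zA andbT; apply: contra zS' => zS; rewrite inE.
      apply/exists_inP; exists (l y) => //; rewrite /R zS; apply/exists_inP.
      by exists y; rewrite ?eqxx.
    by rewrite /l' yD zD -(sepl y z) // yK.
  apply: leq_trans (ok _ l' S' _ _); last 2 first.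
  - exact: subset_trans sS'S sSA.
  - move=> y z yD zD eyz.
    have [yK|yK] := boolP ((y \in D) && (l y \in K)); first exact: sep'.
    have [zK|zK] := boolP ((z \in D) && (l z \in K)).
      by apply/esym/sep' => //; rewrite e_sym.
    by rewrite /l' (negPf yK) (negPf zK).
  rewrite -(card_imset _ (@Some_inj _)); apply: subset_leq_card.
  apply/subsetP=> _ /imsetP[c cK ->]; rewrite inE.
  have := subsetP sKX c cK; rewrite inE.
  suff -> : fiber l' (A :\: S') (Some c) = fiber l D c by [].
  apply/setP=> y; rewrite [LHS]inE [RHS]inE /l'.
  have [yD|yD] := boolP (y \in D); last by rewrite andbF.
  have -> /= : y \in A :\: S'.
    move: yD; rewrite !(inE, in_setD) => /andP[yS ->]; rewrite andbT.
    by apply: contra yS => ?; apply: (subsetP sS'S); rewrite inE.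
  by case: ifPn => lK; rewrite ?(inj_eq (@Some_inj _)) //;
    apply/esym; apply: contraNF lK => /eqP->.
(* By tightness the injection of [X] into [S] is onto. *)
have gX : g @: X = S.
  apply/eqP; rewrite eqEcard card_in_imset // tight andbT.
  by apply/subsetP=> _ /imsetP[c cX ->]; have /andP[] := gR c cX.
(* Each vertex of [S] joins the fiber assigned to it. In the enlarged class it is matched to a
   neighbour [x], and [crit] matches the rest of the fiber. *)
pose h y := if y \in S then [pick c in X | g c == y] else Some (l y).
case: nmA; apply: (matchable_fibers (h := h)).
have hg c : c \in X -> h (g c) = Some c.
  move=> cX; have gS : g c \in S by rewrite -gX imset_f.
  rewrite /h gS; case: pickP => [c' /andP[c'X /eqP gg]|/(_ c)].
    by rewrite (ginj _ _ c'X cX gg).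
  by rewrite cX eqxx.
have hS y : y \in S -> exists2 c, c \in X & y = g c.
  by rewrite -gX => /imsetP.
case=> [c|]; last first.
  have -> : [set y in A | h y == None] = set0; last exact: Matchable0.
  apply/setP=> y; rewrite !inE; apply/negP=> /andP[yA].
  have [/hS[c cX ->]|yS] := boolP (y \in S); first by rewrite hg.
  by rewrite /h (negPf yS).
have [cX|cX] := boolP (c \in X); last first.
  have -> : [set y in A | h y == Some c] = set0; last exact: Matchable0.
  apply/setP=> y; rewrite !inE; apply/negP=> /andP[yA].
  have [/hS[c' c'X ->]|yS] := boolP (y \in S).
    by rewrite hg // => /eqP[E]; rewrite -E c'X in cX.
  rewrite /h (negPf yS) => /eqP[E]; move: cX.
  by rewrite -E inE all_odd // inE yS.
have /andP[gS /exists_inP[x xD /andP[/eqP lx exg]]] := gR c cX.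
have -> : [set y in A | h y == Some c] = g c |: (x |: (fiber l D (l x) :\ x)).
  have xf : x \in fiber l D (l x) by rewrite inE xD eqxx.
  rewrite setD1K //; apply/setP=> y; rewrite lx in_setU1 [y \in fiber _ _ _]inE inE.
  have [yS|yS] := boolP (y \in S).
    rewrite in_setD yS /= orbF (subsetP sSA y yS) /=.
    have [c' c'X ->] := hS y yS; rewrite hg //.
    by apply/eqP/eqP => [[->]|/(ginj _ _ c'X cX)->].
  rewrite /h (negPf yS) in_setD yS /=.
  have -> : (y == g c) = false by apply: contraNF yS => /eqP->.
  by rewrite (inj_eq (@Some_inj _)).
apply: MatchableU2 => //; first by rewrite e_sym.
- by rewrite !inE gS /= andbF.
- by rewrite !inE eqxx.
- exact: crit.
Qed.

End Tutte.

(** * Counting edges between vertex sets *)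

Section EdgeCount.
Variables (T : finType) (e : rel T).
Implicit Types (A B C : {set T}).

(** Ordered pairs are counted: for symmetric irreflexive [e], [ecount A A] is twice the number of
    edges inside [A], while [cut A] counts each boundary edge once. *)
Definition ecount A B : nat := \sum_(x in A) \sum_(y in B) e x y.

Definition cut A := ecount A (~: A).

Lemma sum_rel_card (x : T) B : \sum_(y in B) e x y = #|[set y in B | e x y]|.
Proof.
rewrite -sum1_card [RHS]big_mkcond [LHS]big_mkcond /=.
by apply: eq_bigr => y _; rewrite !inE; case: (y \in B); case: e.
Qed.

Lemma ecount_card A B :
  ecount A B = #|[set p | [&& p.1 \in A, p.2 \in B & e p.1 p.2]]|.
Proof.
rewrite /ecount pair_big_dep -sum1_card [LHS]big_mkcond [RHS]big_mkcond /=.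
apply: eq_bigr => -[x y] _; rewrite inE /=.
by case: (x \in A); case: (y \in B); case: e.
Qed.

Lemma ecountC (e_sym : symmetric e) A B : ecount A B = ecount B A.
Proof.
rewrite /ecount exchange_big; apply: eq_bigr => y _; apply: eq_bigr => x _.
by rewrite e_sym.
Qed.

Lemma cutC (e_sym : symmetric e) A : cut (~: A) = cut A.
Proof. by rewrite /cut setCK ecountC. Qed.

Lemma ecount_split A B C : [disjoint B & C] ->
  ecount A (B :|: C) = ecount A B + ecount A C.
Proof.
move=> dBC; rewrite -big_split; apply: eq_bigr => x _ /=; rewrite -bigU //.
by apply: eq_bigl => y; rewrite !inE.
Qed.

Lemma ecountT A B : ecount A setT = ecount A B + ecount A (~: B).
Proof. by rewrite -ecount_split ?setUCr // -setI_eq0 setICr. Qed.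

Section Regular.
Variable r : nat.
Hypothesis e_reg : forall x, #|[set y | e x y]| = r.

Lemma ecountT_regular A : ecount A setT = #|A| * r.
Proof.
rewrite -sum_nat_const; apply: eq_bigr => x _; rewrite -(e_reg x) sum_rel_card.
by apply: eq_card => y; rewrite !inE.
Qed.

Lemma ecount_cut A : ecount A A + cut A = #|A| * r.
Proof. by rewrite -ecountT -ecountT_regular. Qed.

Lemma ecount_inner (e_irr : irreflexive e) A : ecount A A <= #|A| * #|A|.-1.
Proof.
rewrite -sum_nat_const; apply: leq_sum => x xA.
rewrite (bigD1 x) //= e_irr add0n.
apply: (@leq_trans (\sum_(y in A :\ x) 1)).
  rewrite [X in _ <= X](eq_bigl (fun y => (y \in A) && (y != x))).
    by apply: leq_sum => y _; case: e.
  by move=> y; rewrite !inE andbC.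
by rewrite sum1_card (cardsD1 x A) xA.
Qed.

(** A vertex of [A] has at most [#|A| - 1] neighbours in [A], hence at least [r + 1 - #|A|]
    outside. *)
Lemma leq_cut_regular (e_irr : irreflexive e) A :
  #|A| * (r.+1 - #|A|) <= cut A.
Proof.
by have := ecount_cut A; have := ecount_inner e_irr A; move: (#|A|) => a; nia.
Qed.

End Regular.
End EdgeCount.

(** * The recursive structure of DCells, and cuts seen copy by copy *)

Section DCellStructure.
Variable n : nat.

Local Notation V := (dcell_vertex n).
Local Notation t := (dcell_order n).

Lemma dcell_order0 : t 0 = n.
Proof. by rewrite /dcell_order /= card_ord. Qed.

Lemma dcell_orderS l : t l.+1 = (t l).+1 * t l.
Proof. by rewrite /dcell_order /= card_prod card_ord. Qed.

Lemma uid_lt l (x : V l) : uid x < t l.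
Proof.
elim: l x => [|l IHl] x; first by rewrite dcell_order0 /=.
rewrite dcell_orderS /=; have := IHl x.2; have := ltn_ord x.1.
rewrite -/(dcell_order n l); move: (uid _) (nat_of_ord _) => a b; nia.
Qed.

Lemma uid_inj l : injective (@uid n l).
Proof.
elim: l => [|l IHl] x y /=; first exact: val_inj.
case: x y => [i v] [j w] /= E.
have tl_gt0 : 0 < t l by apply: leq_ltn_trans (uid_lt v).
have ij : i = j.
  apply: val_inj; have := congr1 (divn^~ (t l)) E.
  rewrite -!/(dcell_order n l) ![uid _ + _]addnC !divnMDl //.
  by rewrite !divn_small ?uid_lt // !addn0.
by move: E; rewrite ij => /addIn/IHl ->.
Qed.

Definition uid_ord l (x : V l) : 'I_(t l) := Ordinal (uid_lt x).

Lemma uid_ord_inj l : injective (@uid_ord l).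
Proof. by move=> x y /(congr1 val)/uid_inj. Qed.

Lemma uid_ord_surj l (i : 'I_(t l)) : exists x, uid_ord x = i.
Proof.
have /inj_card_onto H := @uid_ord_inj l.
have : i \in codom (@uid_ord l) by apply: H; rewrite card_ord.
by case/codomP=> x ->; exists x.
Qed.

(* The index of the copy in which the unique external neighbour lies. *)
Definition port l (x : V l.+1) : 'I_(t l).+1 := lift x.1 (uid_ord x.2).

Lemma port_neq l (x : V l.+1) : x.1 != port x.
Proof. exact: neq_lift. Qed.

Lemma port_inj l (i : 'I_(t l).+1) : injective (fun v : V l => port (i, v)).
Proof. by move=> v w /lift_inj/uid_ord_inj. Qed.

(** Lifting past the own index merges the two orientations of the linking rule: for a < b, uid b-1
    lifted past a is b, and uid a lifted past b is a. *)
Lemma dcell_adjS l (x y : V l.+1) :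
  dcell_adj x y =
    if x.1 == y.1 then dcell_adj x.2 y.2 else (port x == y.1) && (port y == x.1).
Proof.
rewrite /= -/(dcell_order n l); case: eqP => // /eqP nxy.
rewrite -!val_eqE /= /bump; have nv : nat_of_ord x.1 <> nat_of_ord y.1 by move/val_inj/eqP; apply/negP.
move: (uid x.2) (uid y.2) nv.
case: x.1 y.1 {nxy} => [a /= _] [b /= _] u v nab.
case: (ltngtP a b) nab => // lt _; apply/idP/idP;
  case: (leqP a u) => ?; case: (leqP b v) => ? /andP[/eqP ? /eqP ?]; lia.
Qed.

Lemma partner_exists l (x : V l.+1) :
  exists v : V l, port ((port x, v) : V l.+1) = x.1.
Proof.
have nx : port x != x.1 by rewrite eq_sym port_neq.
have [i xi _] := unlift_some nx.
by have [v vi] := uid_ord_surj i; exists v; rewrite /port /= vi -xi.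
Qed.

Lemma dcell_regular l (x : V l) : #|[set y | dcell_adj x y]| = n.-1 + l.
Proof.
elim: l x => [|l IHl] x.
  have -> : [set y | dcell_adj x y] = ~: [set x].
    by apply/setP=> y; rewrite !inE /= eq_sym.
  by have := cardsC [set x]; rewrite cards1 card_ord addn0; lia.
have [v pv] := partner_exists x.
pose N0 := [set ((x.1, w) : V l.+1) | w in [set w | dcell_adj x.2 w]].
have -> : [set y | dcell_adj x y] = ((port x, v) : V l.+1) |: N0.
  apply/setP=> -[j w]; rewrite !inE dcell_adjS /=.
  have [<-|nxj] := eqVneq x.1 j.
    rewrite -[_ == _]/((x.1 == port x) && (w == v)) (negPf (port_neq x)) /=.
    apply/idP/imsetP => [a|[w']]; first by exists w; rewrite // inE.
    by rewrite inE => ? [->].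
  have -> : (j, w) \in N0 = false.
    by apply/imsetP=> -[w' _ [jx]]; rewrite jx eqxx in nxj.
  rewrite orbF; apply/andP/eqP => [[/eqP pj /eqP pw]|[-> ->]]; last first.
    by rewrite eqxx pv.
  by rewrite -pj in pw *; congr pair; apply: (@port_inj l (port x)); rewrite pv pw.
rewrite cardsU1 card_imset; last by move=> w w' [].
rewrite IHl; case: imsetP => [[w _ [E]]|_]; last by rewrite addnS.
by have := port_neq x; rewrite E eqxx.
Qed.

Definition slice l (C : {set V l.+1}) (i : 'I_(t l).+1) : {set V l} :=
  [set v | ((i, v) : V l.+1) \in C].

Definition met_copies l (C : {set V l.+1}) := [set i | slice C i != set0].

Lemma sum_slices l (C : {set V l.+1}) (F : V l.+1 -> nat) :
  \sum_(x in C) F x = \sum_i \sum_(v in slice C i) F (i, v).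
Proof.
rewrite pair_big_dep /=; apply: eq_big => [[i v]|[i v] _] //=.
by rewrite inE.
Qed.

Lemma card_slices l (C : {set V l.+1}) : #|C| = \sum_i #|slice C i|.
Proof.
rewrite -sum1_card sum_slices; apply: eq_bigr => i _.
by rewrite sum1_card.
Qed.

Local Notation dcut l := (cut (@dcell_adj n l)).

Lemma outdegree_slices l (C : {set V l.+1}) (x : V l.+1) :
  (\sum_(w in ~: slice C x.1) dcell_adj x.2 w) + (port x \notin met_copies C)
    <= \sum_(y in ~: C) dcell_adj x y.
Proof.
rewrite !sum_rel_card; have [v pv] := partner_exists x.
set O := [set y in ~: C | _].
pose I0 := [set ((x.1, w) : V l.+1) | w in [set w in ~: slice C x.1 | dcell_adj x.2 w]].
have cI : #|I0| = #|[set w in ~: slice C x.1 | dcell_adj x.2 w]|.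
  by rewrite card_imset // => ? ? [].
have sI : I0 \subset O.
  apply/subsetP=> _ /imsetP[w /setIdP[wC a] ->]; rewrite !inE dcell_adjS /= eqxx a.
  by rewrite !inE in wC; rewrite wC.
rewrite -cI; have [pN|pN] := boolP (port x \in met_copies C).
  by rewrite /= addn0 subset_leq_card.
have vC : ((port x, v) : V l.+1) \notin C.
  by apply: contra pN => vC; rewrite inE; apply/set0Pn; exists v; rewrite inE.
have vI : ((port x, v) : V l.+1) \notin I0.
  by apply/imsetP=> -[w' _ [pi _]]; have := port_neq x; rewrite pi eqxx.
rewrite /= addn1 -add1n; have := cardsU1 ((port x, v) : V l.+1) I0; rewrite vI => <-.
apply: subset_leq_card; rewrite subUset sI andbT sub1set !inE vC dcell_adjS /=.
by rewrite (negPf (port_neq x)) eqxx pv eqxx.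
Qed.

(** Vertices of one copy have distinct ports, all different from that copy. So at most [#|N| - 1]
    vertices of a slice are linked to a met copy; every other one adds its linking edge to the
    cut. *)
Lemma dcell_cut_slices l (C : {set V l.+1}) (N := met_copies C) :
  \sum_(i in N) (dcut l (slice C i) + (#|slice C i| - #|N|.-1)) <= dcut l.+1 C.
Proof.
rewrite /(dcut l.+1) /ecount sum_slices big_mkcond /=; apply: leq_sum => i _.
case: ifPn => // iN.
apply: leq_trans (leq_sum _ (fun v _ => outdegree_slices C (i, v))); rewrite big_split leq_add2l /=.
have := cardsID [set v | port ((i, v) : V l.+1) \in N] (slice C i).
have -> : \sum_(v in slice C i) (port ((i, v) : V l.+1) \notin N) =
    #|slice C i :\: [set v | port ((i, v) : V l.+1) \in N]|.
  rewrite -sum1_card [RHS]big_mkcond [LHS]big_mkcond /=.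
  by apply: eq_bigr => v _; rewrite in_setD in_set [X in ~~ X && _]in_set; do 2!case: (_ \in _).
set Q := _ :&: _ => <-.
rewrite leq_subLR leq_add2r.
rewrite -(card_imset _ (@port_inj l i)).
have := cardsD1 i N; rewrite iN add1n => -> /=; apply: subset_leq_card.
apply/subsetP=> _ /imsetP[v vQ ->].
move: vQ; rewrite in_setI => /andP[_]; rewrite in_set => vN.
by rewrite in_setD1 vN andbT eq_sym (port_neq ((i, v) : V l.+1)).
Qed.

Lemma card_met_slices l (C : {set V l.+1}) :
  #|C| = \sum_(i in met_copies C) #|slice C i|.
Proof.
rewrite card_slices [RHS]big_mkcond; apply: eq_bigr => i _.
by case: ifPn => //; rewrite inE negbK => /eqP->; rewrite cards0.
Qed.

(** This and the next definition keep only the sizes needed later. If one copy is met, all [#|A|]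
    linking edges leave [C]; if two are met, each slice loses at most one of them, whence the
    predecessors. *)
Definition cut_in_one_copy l (C : {set V l.+1}) :=
  exists A : {set V l},
    [/\ 0 < #|A| < t l, #|C| = #|A| & dcut l A + #|A| <= dcut l.+1 C].

Definition cut_in_two_copies l (C : {set V l.+1}) :=
  exists A B : {set V l}, [/\ 0 < #|A| < t l, 0 < #|B| < t l, #|C| = #|A| + #|B| &
    dcut l A + dcut l B + (#|A|.-1 + #|B|.-1) <= dcut l.+1 C].

Lemma cut_few_copies l (C : {set V l.+1}) : 0 < #|C| ->
  (forall i, slice C i != setT) -> #|met_copies C| <= 2 ->
  cut_in_one_copy C \/ cut_in_two_copies C.
Proof.
move=> C_gt0 nofull N2.
have range i : i \in met_copies C -> 0 < #|slice C i| < t l.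
  rewrite inE => ne; rewrite card_gt0 ne /=.
  by have := nofull i; rewrite -properT => /proper_card; rewrite cardsT.
have := dcell_cut_slices C; cbv zeta; have := card_met_slices C.
have := N2; rewrite leq_eqVlt ltnS leq_eqVlt ltnS leqn0.
case/or3P=> [/cards2P[i [j [nij E]]]|/cards1P[i E]|]; last 1 first.
- by rewrite cards_eq0 => /eqP->; rewrite big_set0 => C0; rewrite C0 in C_gt0.
- rewrite E !big_setU1 ?inE // !big_set1 cards2 nij /= !subn1 => cC cutC; right.
  exists (slice C i), (slice C j); split=> //; try by apply: range; rewrite E !inE eqxx ?orbT.
  by apply: leq_trans cutC; lia.
- rewrite E !big_set1 cards1 /= subn0 => cC cutC; left.
  by exists (slice C i); split=> //; apply: range; rewrite E inE.
Qed.

(** Call a copy partial if [C] meets it without filling it. Three partial copies give [3 * lam].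
    With at most two, either no copy is full and [C] meets few copies, or no copy is missed and
    [~: C] does, or a full and a missed copy coexist and the linking edges between full and missed
    copies dominate. *)
Lemma dcell_cut_cases l lam (C : {set V l.+1}) :
  0 < lam -> (forall A : {set V l}, 0 < #|A| < t l -> lam <= dcut l A) ->
  0 < #|C| < t l.+1 ->
  [\/ 3 * lam <= dcut l.+1 C, t l <= dcut l.+1 C
    | exists2 C', C' = C \/ C' = ~: C & cut_in_one_copy C' \/ cut_in_two_copies C'].
Proof.
move=> lam_gt0 lamP /andP[C_gt0 C_lt].
set N := met_copies C; pose P := [set i in N | slice C i != setT].
have sPN : P \subset N by apply/subsetP=> i /setIdP[].
have cP i : i \in P -> lam <= dcut l (slice C i).
  case/setIdP; rewrite inE => n0 nT; apply: lamP; rewrite card_gt0 n0 /=.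
  by move: nT; rewrite -properT => /proper_card; rewrite cardsT.
have cutP : #|P| * lam + #|N :\: P| * (t l - #|N|.-1) <= dcut l.+1 C.
  apply: leq_trans (dcell_cut_slices C); rewrite (big_setID P) /= (setIidPr sPN).
  rewrite -!sum_nat_const leq_add // leq_sum // => i; first by move/cP; lia.
  move=> iF; have -> : slice C i = setT.
    by apply/eqP; move: iF; rewrite !inE; case: (slice C i == setT) => //=; rewrite andbT andNb.
  by rewrite cardsT; apply: leq_addl.
have [P3|P2] := leqP 3 #|P|.
  by apply: Or31; apply: leq_trans cutP; rewrite -[3 * lam]addn0 leq_add // leq_mul2r P3 orbT.
have /card_gt0P[c cC] := C_gt0.
have set0nT : set0 != [set: V l].
  by apply/eqP=> /setP/(_ c.2); rewrite !inE.
have [NP|[f fN]] := set_0Vmem (N :\: P).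
  have EN : N = P by apply/eqP; rewrite eqEsubset sPN andbT -setD_eq0 NP.
  apply: Or33; exists C; first by left.
  apply: cut_few_copies; rewrite -/N ?EN //.
  move=> i; have [iN|] := boolP (i \in N).
    by move: iN; rewrite EN inE => /andP[].
  by rewrite inE negbK => /eqP->.
have [NT|NT] := eqVneq N setT; last first.
  (* With p partial and q full copies, p + q (t l + 1 - p - q) is at least t l, because both factors
     of the product are positive. *)
  apply: Or32; apply: leq_trans cutP.
  have N_lt : #|N| < (t l).+1.
    by move: NT; rewrite -properT => /proper_card; rewrite cardsT card_ord.
  have := subset_leq_card sPN; have := cardsDS sPN.
  have : 0 < #|N :\: P| by apply/card_gt0P; exists f.
  by move: (#|N :\: P|) (#|P|) (#|N|) N_lt => a p q; nia.
have sliceC i : slice (~: C) i = ~: slice C i by apply/setP=> v; rewrite !inE.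
apply: Or33; exists (~: C); first by right.
apply: cut_few_copies.
- have := cardsC C; rewrite -/(t l.+1); move: C_lt; rewrite /dcell_order; lia.
- move=> i; rewrite sliceC; have : i \in N by rewrite NT inE.
  by rewrite inE; apply: contraNN => /eqP/(congr1 (@setC _)); rewrite setCK setCT => ->.
- suff -> : met_copies (~: C) = P by [].
  apply/setP=> i; rewrite [RHS]inE NT in_setT inE sliceC.
  by congr (~~ _); apply/eqP/eqP => [/(congr1 (@setC _))|->]; rewrite ?setCK ?setC0 ?setCT.
Qed.

End DCellStructure.

(** * Lower bounds for the edge cuts of DCells *)

Section Connectivity.
Variable n : nat.
Hypothesis n_ge3 : 3 <= n.

Local Notation V := (dcell_vertex n).
Local Notation t := (dcell_order n).
Local Notation dcut l := (cut (@dcell_adj n l)).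

(** Puts the alternative [t l <= dcut l.+1 C] above every cut bound proved below. *)
Lemma dcell_order_ge3 l : 1 <= l -> 3 * (n + l) <= t l.
Proof.
case: l => // l _; elim: l => [|l IHl].
  by rewrite dcell_orderS dcell_order0; nia.
by rewrite dcell_orderS; nia.
Qed.

Lemma dcell_order_ge4 l : 2 <= l -> 4 * (n + l) <= t l.
Proof.
case: l => [|l] // l_gt0; have := dcell_order_ge3 l_gt0.
by rewrite dcell_orderS; nia.
Qed.

Lemma dcell_order_even l : 1 <= l -> ~~ odd (t l).
Proof. by case: l => // l _; rewrite dcell_orderS oddM /= andNb. Qed.

Lemma dcut_generic l (C : {set V l}) :
  #|C| * (n + l - #|C|) <= dcut l C.
Proof.
have := leq_cut_regular (@dcell_regular n l) (@dcell_adj_irrefl n l) C.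
by rewrite -addSn prednK //; lia.
Qed.

(** Both the cut and the two-sided size condition are invariant under complement, so [lo] also
    bounds the side [C'] that meets few copies. *)
Lemma dcut_cases l lam lo (C : {set V l.+1}) :
  0 < lam -> (forall A : {set V l}, 0 < #|A| < t l -> lam <= dcut l A) ->
  0 < lo -> lo <= #|C| -> #|C| + lo <= t l.+1 ->
  [\/ 3 * lam <= dcut l.+1 C, t l <= dcut l.+1 C
    | exists C' : {set V l.+1}, [/\ lo <= #|C'|, dcut l.+1 C' = dcut l.+1 C &
        cut_in_one_copy C' \/ cut_in_two_copies C']].
Proof.
move=> lam_gt0 lamP lo_gt0 loC hiC.
have C_range : 0 < #|C| < t l.+1 by apply/andP; split; lia.
have [H|H|[C' eqC' H]] := dcell_cut_cases lam_gt0 lamP C_range.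
- exact: Or31.
- exact: Or32.
apply: Or33; exists C'; split=> //.
  case: eqC' => -> //; have := cardsC C; move: hiC; rewrite /dcell_order; lia.
by case: eqC' => -> //; rewrite cutC //; apply: dcell_adj_sym.
Qed.

(** By induction on [k]; when one copy is met, the linking edges supply the extra 1 that the new
    level requires. *)
Lemma dcell_connectivity k (C : {set V k}) :
  0 < #|C| < t k -> n + k - 1 <= dcut k C.
Proof.
elim: k C => [|k IHk] C /andP[C_gt0 C_lt].
  have := dcut_generic C; move: C_lt; rewrite dcell_order0 addn0.
  by move: (#|C|) C_gt0 => m; nia.
have tk : n + k <= t k.
  by case: (posnP k) => [->|/dcell_order_ge3]; rewrite ?dcell_order0; lia.
have [|||H|H|[C' [C'_lo <- [[A [/IHk cA EA]]|[A [B [/IHk cA /IHk cB _]]]]]]] :=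
  dcut_cases (lam := n + k - 1) (lo := 1) _ IHk _ C_gt0; try lia.
Qed.

(** Two copies give twice the connectivity. In one copy, m = [#|A|] linking edges suffice when m >=
    n + k - 1 ([k] being the lower level); for smaller m the concave bound m (n + k + 1 - m)
    does. *)
Lemma dcut_bound2 k (C : {set V k}) : 2 <= k ->
  2 <= #|C| -> #|C| + 2 <= t k -> 2 * (n + k) - 4 <= dcut k C.
Proof.
case: k C => // k C k_gt0 C_lo C_hi.
have tk := dcell_order_ge3 (k_gt0 : 1 <= k).
have conn := @dcell_connectivity k.
have [||H|H|[C' [C'_lo <-]]] := dcut_cases _ conn _ C_lo C_hi; try lia.
case=> [[A [cA EA leA]]|[A [B [/conn cA /conn cB _]]]]; last by lia.
have := conn A cA; have := dcut_generic C'; move: (dcut k.+1 C') leA => d.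
by rewrite -EA; move: (#|C'|) C'_lo => m ? ?; have [] := leqP (n + k) m.+1; nia.
Qed.

(** With [k] the lower level, sets of at most n + k - 2 vertices are settled by [dcut_generic].
    Larger ones have enough linking edges on top of [dcut_bound2] or of two connectivity bounds; a
    slice missing a single vertex is itself large enough. *)
Lemma dcut_bound3 k (C : {set V k}) : 3 <= k ->
  3 <= #|C| -> #|C| + 3 <= t k -> 3 * (n + k) - 9 <= dcut k C.
Proof.
case: k C => // k C k_ge2 C_lo C_hi.
have tk := dcell_order_ge3 (ltnW k_ge2 : 1 <= k).
have conn := @dcell_connectivity k.
have [||H|H|[C' [C'_lo <-]]] := dcut_cases _ conn _ C_lo C_hi; try lia.
have gen : #|C'| + 2 <= n + k -> 3 * (n + k.+1) - 9 <= dcut k.+1 C'.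
  have := dcut_generic C'; move: (dcut k.+1 C') (#|C'|) C'_lo => d m; nia.
have [/gen //|m_ge] := leqP (#|C'| + 2) (n + k).
case=> [[A [cA EA leA]]|[A [B [cA cB]]]]; last first.
  by have := conn A cA; have := conn B cB; lia.
have := conn A cA; have [A_hi|] := leqP (#|A| + 2) (t k); last by lia.
by have := dcut_bound2 k_ge2 _ A_hi; lia.
Qed.

(** In one copy, [dcut_bound3] one level down plus four linking edges is exactly enough. In two
    copies only [#|C'| = n + k - 2] (lower level [k]) escapes both the generic and the connectivity
    bound; then one slice has two vertices and obeys [dcut_bound2]. *)
Lemma dcut_bound4 k (C : {set V k}) : 4 <= k ->
  4 <= #|C| -> #|C| + 4 <= t k -> 3 * (n + k) - 8 <= dcut k C.
Proof.
case: k C => // k C k_ge3 C_lo C_hi.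
have tk := dcell_order_ge3 (ltnW (ltnW k_ge3) : 1 <= k).
have conn := @dcell_connectivity k.
have [||H|H|[C' [C'_lo <-]]] := dcut_cases _ conn _ C_lo C_hi; try lia.
case=> [[A [cA EA leA]]|[A [B [cA cB]]]].
  have := conn A cA; have [A_hi|] := leqP (#|A| + 3) (t k); last by lia.
  by have := dcut_bound3 k_ge3 _ A_hi; lia.
have := conn A cA; have := conn B cB => dB dA EC leAB.
have gen : #|C'| + 3 <= n + k -> 3 * (n + k.+1) - 8 <= dcut k.+1 C'.
  have := dcut_generic C'; move: (dcut k.+1 C') (#|C'|) C'_lo => d m; nia.
have [/gen //|m_ge] := leqP (#|C'| + 3) (n + k).
have [m_ge'|m_lt] := leqP (n + k) (#|C'| + 1); first by lia.
have [A2|A1] := leqP 2 #|A|.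
  by have := dcut_bound2 (ltnW k_ge3) A2; lia.
by have := @dcut_bound2 _ B (ltnW k_ge3); lia.
Qed.

End Connectivity.

(** * Preclusion sets and Tutte barriers in a graph *)

Section Barrier.
Variable G : sgraph.
Implicit Types (F : {set {set G}}) (S C : {set G}).

Lemma perfect_matchingPn F : ~~ has_perfect_matching (delete_edges F) ->
  exists (L : finType) (l : G -> L) (S : {set G}),
    separates (delete_adj F) l (~: S) /\ #|S| < #|odd_fibers l (~: S)|.
Proof.
move=> noPM; have nm : ~ matchable (delete_adj F) [set: G].
  move=> /matchable_trivIset[M [tM cM eM]]; case/existsP: noPM; exists M.
  rewrite /perfect_matching /matching tM cM eqxx !andbT.
  apply/subsetP=> f /eM[x [y [exy ->]]]; rewrite inE.
  by apply/existsP; exists x; apply/existsP; exists y; rewrite eqxx andbT.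
have [L [l [S [_]]]] := tutte (@delete_adj_sym G F) nm.
by rewrite setTD => sepl lt; exists L, l, S.
Qed.

Lemma not_isolatedP F : ~~ has_isolated_vertex (delete_edges F) ->
  forall v, exists y, delete_adj F v y.
Proof.
rewrite negb_exists => /forallP niso v; have := niso v.
by rewrite -lt0n => /card_gt0P[y]; rewrite inE; exists y.
Qed.

Lemma card_pairs_leq (P : {set G * G}) F :
  {in P, forall p, [set p.1; p.2] \in F} -> #|P| <= #|F| * 2.
Proof.
move=> PF; rewrite -sum1_card (partition_big (fun p => [set p.1; p.2]) (mem F)) //=.
rewrite -sum_nat_const; apply: leq_sum => f fF; rewrite sum1_card.
case: (pickP [pred p | (p \in P) && ([set p.1; p.2] == f)]) => [[x y] /= /andP[_ /eqP fxy]|none].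
  apply: leq_trans (_ : #|[set (x, y); (y, x)]| <= 2); last first.
    by rewrite cards2; case: eqP.
  apply: subset_leq_card; apply/subsetP=> -[x' y']; rewrite !inE => /andP[_ /eqP].
  rewrite -fxy /= => E.
  have : x' \in [set x; y] by rewrite -E set21.
  have : y' \in [set x; y] by rewrite -E set22.
  have : x \in [set x'; y'] by rewrite E set21.
  have : y \in [set x'; y'] by rewrite E set22.
  rewrite !inE -!pair_eqE /=; do 4![case/orP=> /eqP ?]; subst; by rewrite !eqxx ?orbT.
by rewrite eq_card0.
Qed.

Definition end_edges (u v w : G) : {set {set G}} :=
  [set e in edges G | ((u \in e) || (w \in e)) &&
                      (e \notin [set [set u; v]; [set v; w]])].

Lemma in_edges (x y : G) : ([set x; y] \in edges G) = adj x y.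
Proof.
rewrite inE; apply/existsP/idP => [[a /existsP[b /andP[ab /eqP E]]]|axy]; last first.
  by exists x; apply/existsP; exists y; rewrite axy eqxx.
have : x \in [set a; b] by rewrite -E set21.
have : y \in [set a; b] by rewrite -E set22.
have : a \in [set x; y] by rewrite E set21.
have : b \in [set x; y] by rewrite E set22.
rewrite !inE; do 4![case/orP=> /eqP ?]; subst => //; rewrite ?adj_irrefl // in ab *.
all: by rewrite // adj_sym.
Qed.

Lemma edgesP (e : {set G}) :
  reflect (exists x y, adj x y /\ e = [set x; y]) (e \in edges G).
Proof.
rewrite inE; apply: (iffP existsP) => [[a /existsP[b /andP[ab /eqP E]]]|[a [b [ab E]]]].
  by exists a, b.
by exists a; apply/existsP; exists b; rewrite ab E eqxx.
Qed.

Lemma set2_inj (x y z : G) : [set x; y] = [set x; z] -> y = z.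
Proof.
move=> E; have : y \in [set x; z] by rewrite -E set22.
have : z \in [set x; y] by rewrite E set22.
by rewrite !inE => /orP[] /eqP ? /orP[] /eqP ?; subst.
Qed.

Lemma edges_at (e : {set G}) u : e \in edges G -> u \in e ->
  exists2 y, adj u y & e = [set u; y].
Proof.
case/edgesP=> x [y [axy ->]]; rewrite !inE => /orP[]/eqP->; first by exists y.
by exists x; [rewrite adj_sym | rewrite setUC].
Qed.

(** * Edge counting in a regular graph *)

Section Counting.
Variable r : nat.
Hypothesis G_reg : forall v : G, degree v = r.
Hypothesis r_ge4 : 4 <= r.

(** An edge leaving a fiber ends in [S] or in another fiber. The former number
    [#|S| * r - ecount S S]; the latter all lie in [F] and are counted from both ends. *)
Lemma sum_cut_fibers F (L : finType) (l : G -> L) S :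
  separates (delete_adj F) l (~: S) ->
  \sum_c cut (@adj G) (fiber l (~: S) c) + ecount (@adj G) S S <= #|S| * r + #|F| * 2.
Proof.
move=> sepl; pose P := [set p | [&& p.1 \notin S, p.2 \notin S, adj p.1 p.2 & l p.1 != l p.2]].
have leP : #|P| <= #|F| * 2.
  apply: card_pairs_leq => -[x y]; rewrite inE /= => /and4P[xS yS axy nl].
  apply: contraR nl => nF; apply/eqP/sepl; rewrite ?inE //.
  by rewrite /delete_adj axy nF.
apply: (@leq_trans (#|S| * r + #|P|)); last by rewrite leq_add2l.
have := ecount_cut G_reg S; rewrite /(cut _ S) (ecountC (@adj_sym G)) => <-.
suff -> : \sum_c cut (@adj G) (fiber l (~: S) c) = ecount (@adj G) (~: S) S + #|P|.
  by rewrite addnC addnA.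
have -> : #|P| = \sum_(x in ~: S) \sum_(y in ~: S) (adj x y && (l x != l y)).
  rewrite -sum1_card pair_big_dep /= [LHS]big_mkcond [RHS]big_mkcond /=.
  apply: eq_bigr => -[x y] _; rewrite !inE /=.
  by case: (x \in S); case: (y \in S); case: adj; case: eqP.
rewrite -big_split /= (partition_big l xpredT) //=; apply: eq_bigr => c _.
rewrite /cut /ecount; apply: eq_big => [x|x]; rewrite inE //.
move=> /andP[_ /eqP lx].
rewrite [X in _ = X + _]big_mkcond [X in _ = _ + X]big_mkcond -big_split /= big_mkcond.
apply: eq_bigr => y _; rewrite !inE lx [c == _]eq_sym.
by case: (y \in S); case: adj; case: (l y == c).
Qed.

(** * The trivial solution at a triangle *)

Section Triangle.
Variables u v w : G.
Hypotheses (uv : adj u v) (vw : adj v w) (uw : adj u w).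

Let neq (x y : G) : adj x y -> x != y.
Proof. by apply: contraTneq => ->; rewrite adj_irrefl. Qed.

Lemma card_end_edges : #|end_edges u v w| = 2 * r - 3.
Proof.
(* [U] has r - 1 edges, including uw; [W] therefore omits uw and has r - 2. *)
pose U := [set [set u; y] | y in [set y | adj u y] :\ v].
pose W := [set [set w; y] | y in [set y | adj w y] :\ v :\ u].
have nuv := neq uv; have nvw := neq vw; have nuw := neq uw.
have eqUW : end_edges u v w = U :|: W.
  apply/setP=> e; apply/setIdP/setUP => [[eE /andP[/orP[]ue]]|].
  - have [y uy ->] := edges_at eE ue; rewrite in_set2 negb_or => /andP[n1 _]; left.
    apply/imsetP; exists y => //; rewrite !inE uy andbT.
    by apply: contraNneq n1 => ->.
  - have [y wy E] := edges_at eE ue; rewrite in_set2 negb_or => /andP[_ n2].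
    have nyv : y != v by apply: contraNneq n2 => yv; rewrite E yv setUC.
    have [yu|nyu] := eqVneq y u; [left|right].
      apply/imsetP; exists w; last by rewrite E yu setUC.
      by rewrite !inE eq_sym nvw -yu adj_sym.
    by apply/imsetP; exists y => //; rewrite !inE nyv nyu.
  case=> /imsetP[y yP ->]; rewrite in_edges; move: yP; rewrite !inE => yP.
    case/andP: yP => yv uy; split=> //; rewrite eqxx /= negb_or.
    apply/andP; split; first by apply: contraNneq yv => /set2_inj->.
    apply/eqP => E; have : u \in [set v; w] by rewrite -E set21.
    by rewrite !inE (negPf nuv) (negPf nuw).
  case/and3P: yP => yu yv wy; split=> //; rewrite eqxx orbT /= negb_or.
  apply/andP; split; last by rewrite [[set v; w]]setUC; apply: contraNneq yv => /set2_inj->.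
  apply/eqP => E; have : w \in [set u; v] by rewrite -E set21.
  by rewrite !inE ![w == _]eq_sym (negPf nuw) (negPf nvw).
have dUW : [disjoint U & W].
  rewrite -setI_eq0; apply/eqP/setP=> e; rewrite !inE; apply/negP=> /andP[].
  move=> /imsetP[y _ ->] /imsetP[z]; rewrite !inE => /and3P[zu _ _] E.
  have : u \in [set w; z] by rewrite -E set21.
  by rewrite !inE (negPf nuw) eq_sym (negPf zu).
rewrite eqUW cardsU disjoint_setI0 // cards0 subn0.
rewrite !card_imset; try by [move=> ? ? /set2_inj].
have := cardsD1 v [set y | adj u y]; have := cardsD1 v [set y | adj w y].
have := cardsD1 u ([set y | adj w y] :\ v).
have /(_ u) := G_reg; have /(_ w) := G_reg; rewrite /degree => -> ->.
by rewrite !inE uv ![adj w _]adj_sym vw uw nuv /=; lia.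
Qed.

(** After the deletion [v] is the only neighbour of both [u] and [w], so they cannot both be
    matched. Any other vertex loses at most its edges to [u] and [w], fewer than [r]. *)
Lemma end_edges_preclusion : cond_preclusion_set (end_edges u v w).
Proof.
have nuv := neq uv; have nvw := neq vw; have nuw := neq uw.
apply/and3P; split; first by apply/subsetP=> e /setIdP[].
  apply/existsP=> -[M /andP[/andP[/subsetP sM tM] /eqP cM]].
  have only x : x \in [set u; w] -> [set x; v] \in M.
    move=> xuw; have : x \in cover M by rewrite cM inE.
    case/bigcupP=> f fM xf; have := sM f fM; rewrite inE.
    case/existsP=> a /existsP[b /andP[/andP[ab nab] /eqP E]].
    suff -> : [set x; v] = f by [].
    apply/esym/eqP; move: nab; rewrite -E; apply: contraNT => nf.
    rewrite inE E in_edges ab -E /=; apply/andP; split.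
      by move: xuw; rewrite !inE => /orP[]/eqP <-; rewrite xf ?orbT.
    have fe : f \in edges G by rewrite E in_edges.
    have [y xy Ey] := edges_at fe xf.
    rewrite !inE; apply: contraNN nf => /orP[]/eqP fE; rewrite fE.
      have : x \in [set u; v] by rewrite -fE.
      rewrite !inE => /orP[]/eqP xE; first by rewrite xE.
      by move: xuw; rewrite xE !inE [v == u]eq_sym (negPf nuv) (negPf nvw).
    have : x \in [set v; w] by rewrite -fE.
    rewrite !inE => /orP[]/eqP xE; last by rewrite xE setUC.
    by move: xuw; rewrite xE !inE [v == u]eq_sym (negPf nuv) (negPf nvw).
  have uM := only u (set21 _ _); have wM := only w (set22 _ _).
  have [E|nE] := eqVneq [set u; v] [set w; v].
    have : u \in [set w; v] by rewrite -E set21.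
    by rewrite !inE (negPf nuw) (negPf nuv).
  have /trivIsetP/(_ _ _ uM wM nE) := tM.
  by rewrite -setI_eq0 => /eqP/setP/(_ v); rewrite !inE eqxx !orbT.
apply/existsP=> -[x]; apply/negP; rewrite -lt0n; apply/card_gt0P.
suff [y xy nin] : exists2 y, @adj G x y & [set x; y] \notin end_edges u v w.
  by exists y; rewrite inE; apply/andP.
have [->|xu] := eqVneq x u; first by exists v; rewrite ?inE ?eqxx ?andbF.
have [->|xw] := eqVneq x w.
  exists v; first by rewrite adj_sym.
  by rewrite inE !in_set2 [[set v; w]]setUC !eqxx !orbT andbF.
have /card_gt0P[y] : 0 < #|[set y | @adj G x y] :\ u :\ w|.
  have := cardsD1 u [set y | @adj G x y]; have := cardsD1 w ([set y | @adj G x y] :\ u).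
  by have /(_ x) := G_reg; rewrite /degree; do 2!case: (_ \in _) => /=; lia.
rewrite !inE => /and3P[yw yu xy]; exists y => //.
rewrite inE !in_set2 ![u == _]eq_sym ![w == _]eq_sym.
by rewrite (negPf xu) (negPf xw) (negPf yu) (negPf yw) /= andbF.
Qed.

End Triangle.

(** * Barriers when few edges are deleted *)

Hypothesis G_even : ~~ odd #|G|.
Hypothesis G_conn : forall C, 0 < #|C| < #|G| -> r <= cut (@adj G) C.
Hypothesis G_cut2 : forall C,
  2 <= #|C| -> #|C| + 2 <= #|G| -> 2 * r - 2 <= cut (@adj G) C.
Hypothesis G_cut3 : forall C,
  3 <= #|C| -> #|C| + 3 <= #|G| -> 3 * r - 6 <= cut (@adj G) C.

(** The cut in excess of the [r] edges forced on an odd part. The subtraction is exact: in even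
    order an odd part is non-empty and proper. *)
Definition excess C := cut (@adj G) C - r * odd #|C|.

Lemma excessK C : cut (@adj G) C = excess C + r * odd #|C|.
Proof.
rewrite subnK //; case: (boolP (odd _)) => [oC|]; last by rewrite muln0.
rewrite muln1; apply: G_conn; case: (#|C|) oC (max_card C) => // m om.
by rewrite leq_eqVlt => /predU1P[E|]; first by case/negP: G_even; rewrite -E.
Qed.

(** An odd [C] has, by parity, three vertices on both sides, so its cut is at least 3r - 6, of which
    [r] is subtracted; an even one has cut at least 2r - 2. *)
Lemma excess_ge C : 2 <= #|C| -> #|C| + 2 <= #|G| -> 2 * r - 6 <= excess C.
Proof.
move=> lo hi; have := excessK C; have := G_cut2 lo hi.
case: (boolP (odd #|C|)) => oC /=; last by lia.
have lo3 : 3 <= #|C| by move: lo oC; case: (#|C|) => [|[|[|]]].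
have hi3 : #|C| + 3 <= #|G|.
  rewrite addnS ltn_neqAle hi andbT; apply: contraNneq G_even => <-.
  by rewrite oddD oC.
by have := G_cut3 lo3 hi3; lia.
Qed.

Lemma barrier_excess F (L : finType) (l : G -> L) S :
  separates (delete_adj F) l (~: S) -> #|S| < #|odd_fibers l (~: S)| ->
  #|S| + 2 <= #|odd_fibers l (~: S)| /\
  \sum_c excess (fiber l (~: S) c) + ecount (@adj G) S S
    + #|odd_fibers l (~: S)| * r <= #|S| * r + #|F| * 2.
Proof.
move=> sepl lt; split.
  have := odd_card_odd_fibers l (~: S); have := cardsC S.
  move/(congr1 odd); rewrite oddD [odd #|G|](negPf G_even) => parS par.
  rewrite addn2 ltn_neqAle lt andbT; apply/eqP => E; move: parS.
  by rewrite -par -E /=; case: odd.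
apply: leq_trans (sum_cut_fibers sepl).
rewrite addnAC leq_add2r (eq_bigr _ (fun c _ => excessK _)) big_split leq_add2l /=.
rewrite -big_distrr /= mulnC leq_mul2l; apply/orP; right.
rewrite -sum1_card big_mkcond /=; apply: leq_sum => c _.
by rewrite inE; case: odd.
Qed.

(** Another odd fiber contains some [v], and a surviving edge at [v] ends in [S] or in the fiber of
    [v]: both ends lie outside fiber [c]. *)
Lemma fiber_le F (L : finType) (l : G -> L) S c :
  ~~ has_isolated_vertex (delete_edges F) ->
  separates (delete_adj F) l (~: S) -> #|S| + 2 <= #|odd_fibers l (~: S)| ->
  #|fiber l (~: S) c| + 2 <= #|G|.
Proof.
move=> /not_isolatedP niso sepl q_ge.
have [c1] : exists c1, c1 \in odd_fibers l (~: S) :\ c.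
  by apply/card_gt0P; have := cardsD1 c (odd_fibers l (~: S)); case: (c \in _); lia.
rewrite !inE => /andP[nc1 odd1].
have /card_gt0P[v] : 0 < #|fiber l (~: S) c1| by case: (#|_|) odd1.
rewrite !inE => /andP[vS /eqP lv].
have vc : v \in ~: fiber l (~: S) c by rewrite !inE vS lv nc1.
have [y vy] := niso v.
have yc : y \in ~: fiber l (~: S) c.
  rewrite !inE negb_and; have [//|yS /=] := boolP (y \in S).
  by rewrite -(sepl v y) ?inE // lv.
have nvy : v != y by apply: contraTneq vy => ->; rewrite delete_adj_irrefl.
have := cardsC (fiber l (~: S) c).
suff : 1 < #|~: fiber l (~: S) c| by lia.
by apply/card_gt1P; exists v, y.
Qed.

Variant barrier_shape F (L : finType) (l : G -> L) S : Prop :=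
| SmallFibers of (forall c, #|fiber l (~: S) c| <= 1)
    & ecount (@adj G) S S + 2 * r <= #|F| * 2
| OneLargeFiber c0 of 2 <= #|fiber l (~: S) c0| & #|fiber l (~: S) c0| + 2 <= #|G|
    & #|F| = 2 * r - 3 & ecount (@adj G) S S = 0
    & #|odd_fibers l (~: S)| = #|S| + 2
    & excess (fiber l (~: S) c0) = 2 * r - 6
    & (forall c, c != c0 -> #|fiber l (~: S) c| <= 1).

(** The excesses and [ecount S S] add up to at most 2|F| - 2r <= 2r - 6. One fiber with two vertices
    uses all of this, so every estimate is an equality; a second one would need more, as 2r - 6 >
    0. *)
Lemma barrierP F (L : finType) (l : G -> L) S :
  ~~ has_isolated_vertex (delete_edges F) -> #|F| <= 2 * r - 3 ->
  separates (delete_adj F) l (~: S) -> #|S| < #|odd_fibers l (~: S)| ->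
  barrier_shape F l S.
Proof.
move=> niso F_le sepl lt; have [q_ge sum_le] := barrier_excess sepl lt.
have fib_le c := fiber_le c niso sepl q_ge.
have q_mul : (#|S| + 2) * r <= #|odd_fibers l (~: S)| * r by rewrite leq_mul2r q_ge orbT.
case: (pickP [pred c | 2 <= #|fiber l (~: S) c|]) => [c0 /= lo|small]; last first.
  apply: SmallFibers => [c|]; last by lia.
  by have := small c; rewrite /= ltnNge => /negbFE.
have ex0 := excess_ge lo (fib_le c0).
move: sum_le; rewrite (bigD1 c0) //=; set rest := \sum_(c | _) _ => sum_le.
have [F_eq Z0 q_eq ex_eq rest0] : [/\ #|F| = 2 * r - 3, ecount (@adj G) S S = 0,
    #|odd_fibers l (~: S)| = #|S| + 2, excess (fiber l (~: S) c0) = 2 * r - 6 & rest = 0].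
  move: ex0 sum_le q_mul q_ge F_le; rewrite mulnDl.
  move: (excess _) rest (ecount _ _ _) #|S| #|F| #|odd_fibers _ _| => x y z s f q.
  move=> ex0 sum_le q_mul q_ge F_le.
  have q_eq : q * r = s * r + 2 * r by lia.
  split; try lia.
  by apply/eqP; rewrite -(eqn_pmul2r (_ : 0 < r)) ?q_eq ?mulnDl //; lia.
apply: (OneLargeFiber (c0 := c0)) => // c nc; rewrite leqNgt; apply/negP => lo'.
have := excess_ge lo' (fib_le c).
have : excess (fiber l (~: S) c) <= rest by rewrite /rest (bigD1 c) //= leq_addr.
by lia.
Qed.

Lemma large_fiber_end_edges F (L : finType) (l : G -> L) S c0 :
  separates (delete_adj F) l (~: S) ->
  #|fiber l (~: S) c0| + 3 = #|G| ->
  #|odd_fibers l (~: S)| = #|S| + 2 ->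
  excess (fiber l (~: S) c0) = 2 * r - 6 ->
  (forall c, c != c0 -> #|fiber l (~: S) c| <= 1) ->
  exists u v w, [/\ adj u v, adj v w, adj u w & end_edges u v w \subset F].
Proof.
move=> sepl c0_card q_eq ex0 small; set C0 := fiber _ _ c0 in c0_card ex0.
have oddC0 : odd #|C0|.
  by move: G_even; rewrite -c0_card oddD /= addbT negbK.
(* The three vertices outside [C0] are those of [S] and the other [#|S| + 1] odd fibers, all
   singletons. *)
have S1 : #|S| = 1.
  have := cardsC S; rewrite -(sum_fiber l (~: S)) (bigD1 c0) //= -/C0.
  have := cardsD1 c0 (odd_fibers l (~: S)); rewrite inE oddC0 q_eq.
  suff -> : \sum_(c | c != c0) #|fiber l (~: S) c| = #|odd_fibers l (~: S) :\ c0|.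
    by rewrite -c0_card add1n => ? ?; lia.
  rewrite -sum1_card big_mkcond [RHS]big_mkcond; apply: eq_bigr => c _.
  rewrite !inE; case: eqP => //= /eqP/small; by case: (#|_|) => [|[]].
have [v ES] : exists v, S = [set v] by apply/cards1P/eqP.
have vC0 : v \notin C0 by rewrite !inE ES !inE eqxx.
have : #|~: C0 :\ v| = 2.
  by have := cardsC C0; have := cardsD1 v (~: C0); rewrite in_setC vC0; lia.
move/eqP/cards2P=> [u [w [nuw Euw]]].
have EC0 : ~: C0 = v |: [set u; w] by rewrite -Euw setD1K // inE.
have [nuv nvw] : u != v /\ v != w.
  have : u \in ~: C0 :\ v by rewrite Euw set21.
  have : w \in ~: C0 :\ v by rewrite Euw set22.
  by rewrite !in_setD1 => /andP[wv _] /andP[-> _]; rewrite eq_sym.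
(* The cut of [C0] is 3r - 6, while three vertices have total degree 3r, so all three edges among
   them are present. *)
have tri : [&& adj u v, adj v w & adj u w].
  have := excessK C0; rewrite oddC0 ex0 -(cutC (@adj_sym G)) EC0.
  have := ecount_cut G_reg (v |: [set u; w]).
  have -> : #|v |: [set u; w]| = 3.
    by rewrite cardsU1 !inE [v == u]eq_sym (negPf nuv) (negPf nvw) cards2 nuw.
  have vuw : v \notin [set u; w] by rewrite !inE [v == u]eq_sym (negPf nuv).
  have uw' : u \notin [set w] by rewrite inE.
  rewrite /ecount !(big_setU1, big_set1) // !adj_irrefl.
  rewrite [adj v u]adj_sym [adj w v]adj_sym [adj w u]adj_sym.
  by do 3!case: adj => //=; lia.
exists u, v, w; case/and3P: tri => uv vw uw; split=> //.
(* The fibers of [u] and [w] are singletons, so an edge from them that avoids [v] joins two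
   fibers. *)
have escape x y : x \in [set u; w] -> adj x y -> y != v -> [set x; y] \in F.
  move=> xuw xy yv; apply/negPn/negP => nF.
  have xC : x \in ~: C0 by rewrite EC0 inE xuw orbT.
  have xS : x \in ~: S.
    rewrite ES !inE; move: xuw; rewrite !inE => /orP[]/eqP->//.
    by rewrite eq_sym.
  have yS : y \in ~: S by rewrite ES !inE.
  have lxy : l x = l y by apply: sepl => //; rewrite /delete_adj xy nF.
  have nc : l x != c0 by move: xC; rewrite inE [x \in C0]inE xS.
  have := small _ nc; apply/negP; rewrite -ltnNge; apply/card_gt1P.
  exists x, y; split; [by rewrite inE xS eqxx | by rewrite inE yS lxy eqxx |].
  by apply: contraTneq xy => ->; rewrite adj_irrefl.
apply/subsetP=> e /setIdP[eE /andP[/orP[]xe]]; have [y xy ->] := edges_at eE xe;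
  rewrite !inE negb_or => /andP[n1 n2]; apply: escape; rewrite // ?set21 ?set22 //.
  by apply: contraNneq n1 => ->.
by apply: contraNneq n2 => ->; rewrite setUC.
Qed.

End Counting.
End Barrier.

(** * Small preclusion sets of DCells *)

Section DCellPreclusion.
Variable n : nat.
Hypothesis n_ge3 : 3 <= n.

Local Notation V := (dcell_vertex n).
Local Notation t := (dcell_order n).

Lemma dcell_triangle l : exists a b c : V l,
  [/\ dcell_adj a b, dcell_adj b c & dcell_adj a c].
Proof.
elim: l => [|l [a [b [c [ab bc ac]]]]].
  case: n n_ge3 => [|[|[|m]]] // _.
  by exists (inord 0), (inord 1), (inord 2); rewrite /= -!val_eqE /= !inordK.
by exists (ord0, a), (ord0, b), (ord0, c); split; rewrite dcell_adjS eqxx.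
Qed.

(* Each copy contains a triangle, hence a vertex of [W], an edge of [F], or an
   edge inside [S]. *)
Lemma copies_leq l (F : {set {set V l.+1}}) (S W : {set V l.+1}) :
  (forall x y, x \notin S -> y \notin S -> x \notin W -> y \notin W ->
     dcell_adj x y -> [set x; y] \in F) ->
  t l < #|W| + #|F| + ecount (@dcell_adj n l.+1) S S.
Proof.
move=> inF.
(* Only edges of [F] inside a single copy matter, so any endpoint names the copy; [ord0] is the
   value on the empty set. *)
pose copy (f : {set V l.+1}) := if [pick x in f] is Some x then x.1 else ord0.
pose P := [set p : V l.+1 * V l.+1 | [&& p.1 \in S, p.2 \in S & dcell_adj p.1 p.2]].
rewrite ecount_card -/P.
pose U := (@fst _ _ @: W) :|: (copy @: F) :|: ((fun p => p.1.1) @: P).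
have leU : #|U| <= #|W| + #|F| + #|P|.
  rewrite !(leq_trans (leq_card_setU _ _)) ?leq_add ?leq_imset_card //.
  by rewrite (leq_trans (leq_card_setU _ _)) ?leq_add ?leq_imset_card.
apply: leq_trans leU; suff /subset_leq_card : setT \subset U.
  by rewrite cardsT; apply: leq_trans; rewrite card_ord.
apply/subsetP=> i _.
have sameside (v w : V l) : dcell_adj v w ->
    (((i, v) : V l.+1) \in S) = (((i, w) : V l.+1) \in S) -> i \in U.
  set x : V l.+1 := (i, v); set y : V l.+1 := (i, w) => vw eqS.
  have xy : dcell_adj x y by rewrite dcell_adjS eqxx.
  rewrite !in_setU; case: (boolP (x \in W)) => [xW|xW].
    by rewrite (imset_f (@fst _ _) xW).
  case: (boolP (y \in W)) => [yW|yW]; first by rewrite (imset_f (@fst _ _) yW).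
  case: (boolP (x \in S)) => [xS|xS].
    have pP : (x, y) \in P by rewrite inE; apply/and3P; split; rewrite // -eqS.
    by rewrite (imset_f (fun p => p.1.1) pP) orbT.
  have yS : y \notin S by rewrite -eqS.
  have := imset_f copy (inF _ _ xS yS xW yW xy); rewrite /copy.
  case: pickP => [z|/(_ x)]; last by rewrite set21.
  by rewrite in_set2 => /orP[]/eqP-> /= ->; rewrite orbT.
(* Two of the three vertices of a triangle are on the same side of [S]. *)
have [a [b [c [ab bc ac]]]] := dcell_triangle l.
have := sameside a b ab; have := sameside b c bc; have := sameside a c ac.
by do 3!case: (_ \in S); do ?[by move=> /(_ erefl)|by move=> _ /(_ erefl)|by move=> _ _ /(_ erefl)].
Qed.

(** Gives both the lower bound for the minimum and, for [k >= 4], the shape of the sets attaining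
    it. *)
Lemma dcell_preclusion k (F : {set {set DCell k n}}) : 3 <= k ->
  cond_preclusion_set F -> #|F| <= 2 * (n + k - 1) - 3 ->
  #|F| = 2 * (n + k - 1) - 3 /\
  (4 <= k -> exists u v w : DCell k n,
    [/\ adj u v, adj v w, adj u w & end_edges u v w \subset F]).
Proof.
case: k F => // l F l_ge2 /and3P[_ noPM niso] F_le.
set r := n + l.+1 - 1 in F_le *.
have reg (v : DCell l.+1 n) : degree v = r by rewrite /degree dcell_regular /r; lia.
have even : ~~ odd #|DCell l.+1 n| by exact: dcell_order_even.
have r_ge4 : 4 <= r by rewrite /r; lia.
have conn := @dcell_connectivity n n_ge3 l.+1.
have cut2 (C : {set DCell l.+1 n}) : 2 <= #|C| -> #|C| + 2 <= #|DCell l.+1 n| ->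
    2 * r - 2 <= cut (@adj (DCell l.+1 n)) C.
  by move=> lo hi; have := @dcut_bound2 n n_ge3 l.+1 C (ltnW l_ge2) lo hi; rewrite /r /=; lia.
have cut3 (C : {set DCell l.+1 n}) : 3 <= #|C| -> #|C| + 3 <= #|DCell l.+1 n| ->
    3 * r - 6 <= cut (@adj (DCell l.+1 n)) C.
  by move=> lo hi; have := @dcut_bound3 n n_ge3 l.+1 C l_ge2 lo hi; rewrite /r /=; lia.
have [L [lab [S [sepl lt]]]] := perfect_matchingPn noPM.
have order_ge := dcell_order_ge4 n_ge3 l_ge2.
have joined x y : x \notin S -> y \notin S -> #|fiber lab (~: S) (lab x)| <= 1 ->
    @adj (DCell l.+1 n) x y -> [set x; y] \in F.
  move=> xS yS small xy; apply: contraLR small => nF.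
  have xy' : delete_adj F x y by apply/andP.
  rewrite -ltnNge; apply/card_gt1P; exists x, y; split.
  - by rewrite !inE xS eqxx.
  - by rewrite !inE yS (sepl x y) ?inE ?eqxx.
  - by apply: contraTneq xy => ->; rewrite adj_irrefl.
have copies (W : {set DCell l.+1 n}) :
    (forall x, x \notin S -> x \notin W -> #|fiber lab (~: S) (lab x)| <= 1) ->
    t l < #|W| + #|F| + ecount (@adj (DCell l.+1 n)) S S.
  move=> small; apply: copies_leq => x y xS yS xW _; apply: joined => //.
  exact: small.
case: (barrierP reg r_ge4 even conn cut2 cut3 niso F_le sepl lt).
  (* With singleton fibers only, [#|F| <= 2r - 3] and [ecount S S <= 2r - 6], where r = n + l; their
     sum is below [4 * (n + l) <= t l]. *)
  move=> small Z_le; have := copies set0 (fun x _ _ => small _).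
  by rewrite cards0; move: Z_le F_le order_ge; rewrite /r; lia.
move=> c0 lo hi F_eq Z0 q_eq ex0 small; split=> // k_ge4.
have := excessK even conn (fiber lab (~: S) c0); rewrite ex0 => cutE.
(* A large fiber of three vertices serves as [W]: then t l < 3 + (2r - 3), which is impossible. *)
have [c3|c_n3] := eqVneq #|fiber lab (~: S) c0| 3.
  have := copies (fiber lab (~: S) c0); rewrite c3 Z0 F_eq.
  suff H x : x \notin S -> x \notin fiber lab (~: S) c0 ->
      #|fiber lab (~: S) (lab x)| <= 1.
    by move/(_ H); move: order_ge; rewrite /r; lia.
  by move=> xS xc; apply: small; move: xc; rewrite !inE xS.
have [c3'|c_n3'] := eqVneq (#|fiber lab (~: S) c0| + 3) #|DCell l.+1 n|.
  exact: (large_fiber_end_edges reg r_ge4 even conn sepl c3' q_eq ex0 small).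
(* The cut is 2r - 6 for an even fiber, against [cut2]. For an odd one it is 3r - 6, while parity
   leaves at least four vertices on both sides and [dcut_bound4] demands 3r - 5. *)
have := cut2 _ lo hi; rewrite cutE.
case: (boolP (odd _)) => oC; last by lia.
have := @dcut_bound4 n n_ge3 l.+1 (fiber lab (~: S) c0) k_ge4.
have lo4 : 4 <= #|fiber lab (~: S) c0|.
  by move: lo c_n3 oC; case: #|_| => [|[|[|[|]]]].
have hi4 : #|fiber lab (~: S) c0| + 4 <= t l.+1.
  have : #|fiber lab (~: S) c0| + 2 != t l.+1.
    apply: contraNneq (even : ~~ odd (t l.+1)) => <-.
    by rewrite oddD oC.
  by move: hi c_n3'; rewrite -[#|DCell _ _|]/(t l.+1); lia.
move=> /(_ lo4 hi4); rewrite -[cut _ _]/(cut (@adj (DCell l.+1 n)) _) cutE oC /r.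
by lia.
Qed.

End DCellPreclusion.

Theorem theorem26 :
  (forall k n : nat, 3 <= k -> 3 <= n ->
     is_mp1 (DCell k n) (2 * n + 2 * k - 5)) /\
  (forall k n : nat, 4 <= k -> 3 <= n ->
     cond_super_matched (DCell k n)).
Proof.
have reg k n (v : DCell k n) : 3 <= n -> degree v = n + k - 1.
  by move=> n_ge3; rewrite /degree dcell_regular; lia.
have mp1 k n : 3 <= k -> 3 <= n -> is_mp1 (DCell k n) (2 * n + 2 * k - 5).
  move=> k_ge3 n_ge3; have -> : 2 * n + 2 * k - 5 = 2 * (n + k - 1) - 3 by lia.
  have [u [v [w [uv vw uw]]]] := dcell_triangle n_ge3 k.
  have r_ge4 : 4 <= n + k - 1 by lia.
  have reg' v' := reg k n v' n_ge3.
  split; first exists (@end_edges (DCell k n) u v w).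
  - exact: (end_edges_preclusion reg' r_ge4).
  - exact: (card_end_edges reg' r_ge4).
  move=> F condF; rewrite leqNgt; apply/negP => lt.
  by have [E _] := dcell_preclusion n_ge3 k_ge3 condF (ltnW lt); rewrite E ltnn in lt.
split=> // k n k_ge4 n_ge3; have k_ge3 := ltnW k_ge4.
have reg' v' := reg k n v' n_ge3; have r_ge4 : 4 <= n + k - 1 by lia.
have ve_edge (u w : DCell k n) : adj u w -> ve_value u w = 2 * n + 2 * k - 5.
  by move=> uw; rewrite /ve_value uw !reg'; lia.
have neq (u w : DCell k n) : adj u w -> u != w.
  by apply: contraTneq => ->; rewrite adj_irrefl.
(* In a regular graph the minimum is reached when the ends of the path are adjacent, as in a
   triangle. *)
have ve : is_ve (DCell k n) (2 * n + 2 * k - 5).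
  split=> [|u v w _]; last by rewrite /ve_value !reg'; case: adj; lia.
  have [u [v [w [uv vw uw]]]] := dcell_triangle n_ge3 k.
  by exists u, v, w; split; [apply/and3P; split=> //; apply: neq | apply: ve_edge].
exists (2 * n + 2 * k - 5); split=> //; first exact: mp1.
move=> F condF F_eq.
have F_le : #|F| <= 2 * (n + k - 1) - 3 by rewrite F_eq; lia.
have [_ /(_ k_ge4) [u [v [w [uv vw uw sF]]]]] := dcell_preclusion n_ge3 k_ge3 condF F_le.
exists u, v, w; split; first by rewrite /path2 uv vw neq.
  by rewrite ve_edge.
by apply/esym/eqP; rewrite eqEcard sF (card_end_edges reg' r_ge4).
Qed.
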